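(* Let $\beta\in S_n$ have cycle type $(c_1,\dots,c_n)$ and let $k$ be an integer with $3\le k\le n$. Then \[ c(\lambda_{k^{(1)}},\beta)=|C_{S_n}(\beta)|\sum_{\ell= k}^{n} c_\ell\binom{\ell}{k} f(k). \]
   Context: $S_n$ is the symmetric group on $[n]$, products composed right to left. The cycle type $(c_1,\dots,c_n)$ means $\beta$ has exactly $c_i$ cycles of length $i$ (fixed points counted as $1$-cycles). $C_{S_n}(\beta)$ is the centralizer of $\beta$ in $S_n$. A point $a$ is a bad commuting point of $\alpha,\beta$ if $\alpha\beta(a)\ne\beta\alpha(a)$; $\alpha$ $k$-commutes with $\beta$ if there are exactly $k$ bad commuting points. $c(\lambda_{k^{(1)}},\beta)$ is the number of $\alpha\in S_n$ that $k$-commute with $\beta$ and such that all $k$ bad commuting points lie in a single cycle of $\beta$. $f(k)$ is the number of $k$-cycles $\tau$ of $\{1,\dots,k\}$ with $\tau(a)\ne a+1 \bmod k$ for all $a\in[k]$ (with the convention $k \bmod k=k$). *)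

(* Defs.v *)
From mathcomp Require Import all_boot all_fingroup.

Set Implicit Arguments.
Unset Strict Implicit.
Unset Printing Implicit Defensive.

(* Permutations act on 'I_n = {0, ..., n-1}, the point a of {1, ..., n} being
   encoded as a - 1.  MathComp's product of permutations is composed left to
   right, so the right-to-left product "alpha beta" is spelled out pointwise
   as a |-> alpha (beta a). *)

Definition bad_commuting_point n (alpha beta : 'S_n) (a : 'I_n) : bool :=
  alpha (beta a) != beta (alpha a).

Definition bad_commuting_points n (alpha beta : 'S_n) : {set 'I_n} :=
  [set a | bad_commuting_point alpha beta a].

Definition k_commutes k n (alpha beta : 'S_n) : bool :=
  #|bad_commuting_points alpha beta| == k.

(* The cycles of beta, fixed points included, are identified with their
   supports, i.e. with the elements of porbits beta.  Only c 1, ..., c n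
   are meaningful. *)
Definition has_cycle_type n (beta : 'S_n) (c : nat -> nat) : Prop :=
  forall i, 1 <= i <= n -> #|[set C in porbits beta | #|C| == i]| = c i.

Definition c_lambda_single k n (beta : 'S_n) : nat :=
  #|[set alpha : 'S_n | k_commutes k alpha beta &
      [exists C in porbits beta, bad_commuting_points alpha beta \subset C]]|.

Definition full_cycle k (tau : 'S_k) : bool := porbits tau == [set [set: 'I_k]].

(* ordS a is the cyclic successor (a + 1) %% k, which in the 0-based encoding
   is a |-> a + 1 mod k on {1, ..., k} with representative k instead of 0. *)
Definition f_count (k : nat) : nat :=
  #|[set tau : 'S_k | full_cycle tau & [forall a, tau a != ordS a]]|.

(* Main.v *)
(* The bad commuting points of alpha and beta are the points where beta and its
   conjugate t = alpha^-1 beta alpha disagree, and each conjugate t comes from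
   |C(beta)| permutations alpha.  If t disagrees with beta exactly on a k-subset
   K of a cycle C of beta, then t is conjugate to beta iff C is also a cycle of
   t.  Contracting C to K (first return maps) and labelling K cyclically turns
   beta into a |-> a + 1 and t into a permutation tau that differs from
   a |-> a + 1 everywhere, and C is a cycle of t iff tau is a k-cycle.  Hence
   every such K contributes f(k), and a cycle of length l has 'C(l, k) of them. *)

Require Import Defs.
From mathcomp Require Import all_boot all_fingroup.

Set Implicit Arguments.
Unset Strict Implicit.
Unset Printing Implicit Defensive.

(** * Conjugates of a permutation and cosets of its centralizer *)

Definition disagreement (T : finType) (s t : {perm T}) : {set T} :=
  [set y | t y != s y].

(** The fibre of [g |-> s ^ g] through [g] is the right coset ['C[s] :* g], and [P] is constant on
    it. *)
Lemma card_conjg_preim (gT : finGroupType) (s : gT) (P : pred gT) :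
  #|[set g | P (s ^ g)%g]| =
    #|'C[s]%g| * #|[set t in (s ^: [set: gT])%g | P t]|.
Proof.
rewrite mulnC -sum_nat_const -sum1_card.
rewrite (partition_big (fun g => s ^ g)%g
  (mem [set t in (s ^: [set: gT])%g | P t])) /=; last first.
  by move=> g; rewrite !inE => Pg; rewrite Pg andbT memJ_class ?inE.
apply: eq_bigr => t; rewrite inE => /andP[/imsetP[g _ ->] Pg].
rewrite sum1dep_card -[RHS](card_rcoset _ g); apply: eq_card => x.
have centE z : (z \in 'C[s]%g) = (s ^ z == s)%g.
  by rewrite cent1C (sameP cent1P commgP) (sameP conjg_fixP eqP).
rewrite inE mem_rcoset centE [in LHS]inE.
rewrite conjgM -[RHS](inj_eq (conjg_inj g)) conjgKV.
by case: eqP => [->|_]; rewrite ?Pg ?andbF.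
Qed.

(** * Powers and cycles of one permutation *)

Lemma permX_mod_porbit (T : finType) (s : {perm T}) x i :
  ((s ^+ i) x = (s ^+ (i %% #|porbit s x|)) x)%g.
Proof.
rewrite {1}(divn_eq i #|porbit s x|) expgD permM mulnC expgM.
by congr (fun_of_perm _ _); apply: permX_fix; rewrite permX iter_porbit.
Qed.

Lemma index_porbit (T : finType) (s : {perm T}) x i :
  index ((s ^+ i)%g x) (traject s x #|porbit s x|) = i %% #|porbit s x|.
Proof.
have lt_i : i %% #|porbit s x| < #|porbit s x|.
  by rewrite ltn_pmod // lt0n card_porbit_neq0.
rewrite permX_mod_porbit permX -(nth_traject _ lt_i) index_uniq //.
  by rewrite size_traject.
exact: uniq_traject_porbit.
Qed.

Lemma mem_porbit_perm (T : finType) (s : {perm T}) x y :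
  (s y \in porbit s x) = (y \in porbit s x).
Proof. by rewrite -!eq_porbit_mem (porbit_perm s 1 y). Qed.

Lemma porbit_mem_eq (T : finType) (s : {perm T}) C x :
  C \in porbits s -> x \in C -> C = porbit s x.
Proof.
by case/imsetP=> y _ -> xC; apply/eqP; rewrite eq_sym eq_porbit_mem.
Qed.

Lemma porbit_conjg (T : finType) (s g : {perm T}) x :
  porbit (s ^ g)%g (g x) = g @: porbit s x.
Proof.
have conjE i : ((s ^ g) ^+ i)%g (g x) = g ((s ^+ i)%g x).
  by rewrite -conjXg permJ.
apply/setP=> y; apply/porbitP/imsetP => [[i ->]|[_ /porbitP[i ->] ->]].
  by exists ((s ^+ i)%g x); rewrite ?mem_porbit.
by exists i.
Qed.

Lemma card_porbits_conjg (T : finType) (s g : {perm T}) :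
  #|porbits (s ^ g)%g| = #|porbits s|.
Proof.
rewrite -(card_imset (porbits s) (imset_inj (@perm_inj _ g))).
apply: eq_card => C; apply/imsetP/imsetP => [[x _ ->]|[_ /imsetP[x _ ->] ->]].
  exists (porbit s ((g^-1)%g x)); first exact: imset_f.
  by rewrite -porbit_conjg permKV.
by exists (g x); rewrite // porbit_conjg.
Qed.

(** * Conjugacy of permutations that differ only inside one cycle *)

Lemma porbit_eq_off (T : finType) (s t : {perm T}) C y :
    C \in porbits s -> disagreement s t \subset C -> y \notin C ->
  porbit t y = porbit s y.
Proof.
move=> Cs sC yC.
(* The [s]-cycle of [y] never enters [C], so [s] and [t] agree all along it. *)
have nC i : (s ^+ i)%g y \notin C.
  apply: contra yC => iC; rewrite (porbit_mem_eq Cs iC).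
  by rewrite porbit_perm porbit_id.
have tE i : (t ^+ i)%g y = (s ^+ i)%g y.
  elim: i => [|i IH]; first by rewrite !expg0.
  rewrite !expgSr !permM IH; apply/eqP/negPn.
  apply: contra (nC i) => neq; apply: (subsetP sC).
  by rewrite inE.
by apply/setP=> z; apply/porbitP/porbitP => -[i ->]; exists i.
Qed.

(* Off C the permutations s and t have the same cycles, so if they have equally
   many cycles then exactly one cycle of t is left to cover C. *)
Lemma porbits_of_card (T : finType) (s t : {perm T}) C :
    C \in porbits s -> disagreement s t \subset C ->
    #|porbits t| = #|porbits s| -> C \in porbits t.
Proof.
move=> Cs sC eq_card.
have sub : porbits s :\ C \subset porbits t.
  apply/subsetP=> D; rewrite !inE => /andP[DC /imsetP[y _ Dy]].
  rewrite Dy -(porbit_eq_off Cs sC) ?imset_f //.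
  by apply: contra DC => yC; rewrite Dy (porbit_mem_eq Cs yC).
have /cards1P[D defD] : #|porbits t :\: (porbits s :\ C)| == 1.
  rewrite cardsD (setIidPr sub) eq_card (cardsD1 C (porbits s)) Cs.
  by rewrite addnK.
have tC x : x \in C -> porbit t x = D.
  move=> xC; apply/set1P; rewrite -defD !inE imset_f // andbT.
  rewrite negb_and negbK orbC -implybE; apply/implyP => /porbit_mem_eq.
  move/(_ _ (porbit_id t x)) => ->.
  by rewrite -(porbit_mem_eq Cs xC).
have : D \in porbits t :\: (porbits s :\ C) by rewrite defD set11.
rewrite 2!inE => /andP[nD Dt].
suff -> : C = D by [].
apply/eqP; rewrite eqEsubset; apply/andP; split; apply/subsetP=> y.
  by move/tC <-; exact: porbit_id.
(* A point of [D] outside [C] would make [D] a cycle of [s] other than [C]. *)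
move=> yD; apply: contraNT nD => yC.
rewrite (porbit_mem_eq Dt yD) (porbit_eq_off Cs sC) //.
rewrite !inE imset_f // andbT.
by apply: contraNneq yC => <-; exact: porbit_id.
Qed.

(** The conjugating [g] sends [s^i x] to [t^i x] on [C] and fixes all other points. It does not
    depend on the choice of [i] because both cycles through [x] have length [#|C|]. *)
Lemma conjg_of_porbits (T : finType) (s t : {perm T}) C :
    C \in porbits s -> C \in porbits t -> disagreement s t \subset C ->
  t \in (s ^: [set: {perm T}])%g.
Proof.
move=> Cs Ct sC; case/imsetP: (Cs) => x _ defC.
have xC : x \in C by rewrite defC porbit_id.
have defCt := porbit_mem_eq Ct xC.
pose g y := if y \in C
  then (t ^+ index y (traject s x #|porbit s x|))%g x else y.
have gX i : g ((s ^+ i)%g x) = (t ^+ i)%g x.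
  rewrite /g {1}defC mem_porbit index_porbit.
  by rewrite -defC {1}defCt -permX_mod_porbit.
have gC y : (g y \in C) = (y \in C).
  rewrite /g; case: ifP => [_|->//].
  by rewrite {1}defCt mem_porbit.
have g_inj : injective g.
  move=> y z eq_g; have := gC z; rewrite -eq_g gC => yz.
  case: (boolP (y \in C)) (yz) eq_g => [yC zC|/negPf yC zC]; last first.
    by rewrite /g yC -zC.
  move: yC; rewrite {1}defC => /porbitP[i ->].
  move: (esym zC); rewrite {1}defC => /porbitP[j ->].
  rewrite !gX permX_mod_porbit [in RHS]permX_mod_porbit -defCt defC.
  rewrite (permX_mod_porbit s x i) (permX_mod_porbit s x j).
  have lt_m m : m %% #|porbit s x| < #|porbit t x|.
    by rewrite -defCt defC ltn_pmod // lt0n card_porbit_neq0.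
  rewrite !permX -!(nth_traject t (lt_m _)) => /eqP.
  by rewrite nth_uniq ?size_traject ?uniq_traject_porbit // => /eqP ->.
apply/imsetP; exists (perm g_inj); rewrite ?inE //.
apply/permP=> y; rewrite -[y](permKV (perm g_inj)).
move: ((perm g_inj)^-1 y)%g => {}y; rewrite permJ !permE.
case: (boolP (y \in C)) => yC.
  move: yC; rewrite defC => /porbitP[i ->].
  by rewrite -permM -expgSr !gX expgSr permM.
have sy : s y \notin C by rewrite defC mem_porbit_perm -defC.
rewrite /g (negPf yC) (negPf sy); apply/eqP/negPn.
by apply: contra yC => neq; apply: (subsetP sC); rewrite inE.
Qed.

Lemma porbits_conjgE (T : finType) (s t : {perm T}) C :
    C \in porbits s -> disagreement s t \subset C ->
  (t \in (s ^: [set: {perm T}])%g) = (C \in porbits t).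
Proof.
move=> Cs sC; apply/idP/idP => [/imsetP[g _ deft]|Ct].
  by apply: (@porbits_of_card _ s) => //; rewrite deft card_porbits_conjg.
exact: (@conjg_of_porbits _ _ _ C).
Qed.

(** * Contraction of a cycle to a subset *)

(* e lists K in the order in which the cycle of x meets it, and h sends a point
   of that cycle to the index of the first point of K reached from it. *)
Lemma cyclic_indexing (T : finType) (s : {perm T}) (x : T) (K : {set T}) k :
    K \subset porbit s x -> #|K| = k -> 0 < k ->
  exists (e : 'I_k -> T) (h : T -> 'I_k),
    [/\ forall i, e i \in K, cancel e h, {in K, cancel h e},
        forall i, h (s (e i)) = ordS i
      & forall y, y \in porbit s x -> y \notin K -> h (s y) = h y].
Proof.
move=> sK cardK k_gt0; set c := #|porbit s x|.
have c_gt0 : 0 < c by rewrite lt0n card_porbit_neq0.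
(* [H m] counts the points of [K] among the first [m] points of the cycle, starting at [x]. *)
pose H m := count (mem K) (traject s x m).
have HS m : H m.+1 = H m + ((s ^+ m)%g x \in K).
  by rewrite /H trajectSr -cats1 count_cat /= addn0 permX.
have H_mono m m' : m <= m' -> H m <= H m'.
  by move/subnKC <-; rewrite /H trajectD count_cat leq_addr.
have Hc : H c = k.
  rewrite -cardK /H -size_filter; apply/esym.
  rewrite -(card_uniqP _) ?filter_uniq ?uniq_traject_porbit //.
  apply: eq_card => y; rewrite mem_filter -porbit_traject /= andbC.
  by case: (boolP (y \in K)) => [/(subsetP sK) ->|]; rewrite ?andbF.
have H_mod m : H m = H (m %% c) %[mod k].
  have HD q r : H (q * c + r) = q * k + H r.
    elim: q => // q IH; rewrite !mulSn -!addnA -IH {1}/H trajectD count_cat.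
    by rewrite iter_porbit -Hc.
  by rewrite {1}(divn_eq m c) HD modnMDl.
(* Past the last point of [K] the count is [k]. Reduction modulo [k] turns it into 0, the index of
   the first point of [K] met after wrapping around to [x]. *)
pose h y := Ordinal (ltn_pmod (H (index y (traject s x c))) k_gt0).
have hX m : val (h ((s ^+ m)%g x)) = H m %% k.
  by rewrite /h /= index_porbit -H_mod.
have hS y : y \in porbit s x -> val (h (s y)) = (h y + (y \in K)) %% k.
  case/porbitP=> m ->; rewrite -permM -expgSr hX HS.
  by rewrite -[in LHS]modnDml -hX.
have posP y : y \in K -> exists2 m, m < c & y = (s ^+ m)%g x.
  move=> /(subsetP sK) /porbitP[m ->]; exists (m %% c); first exact: ltn_pmod.
  exact: permX_mod_porbit.
(* A point of [K] enters the count only one step later. On [K] the counts thus stay below [k], where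
   reduction changes nothing, and increase strictly. *)
have h_inj : {in K &, injective h}.
  move=> y z yK zK /(congr1 val).
  have [p lt_p defy] := posP y yK; have [q lt_q defz] := posP z zK.
  have ltS m m' : m < m' -> (s ^+ m)%g x \in K -> H m < H m'.
    by move=> lt_m mK; apply: leq_trans (H_mono _ _ lt_m); rewrite HS mK addn1.
  have lt_k m : m < c -> (s ^+ m)%g x \in K -> H m < k.
    by move=> /ltS lt_m /lt_m; rewrite Hc.
  rewrite defy defz in yK zK *; rewrite !hX !modn_small ?lt_k // => eqH.
  have [lt_pq|lt_qp|->//] := ltngtP p q.
    by have := ltS _ _ lt_pq yK; rewrite eqH ltnn.
  by have := ltS _ _ lt_qp zK; rewrite eqH ltnn.
have h_onto i : exists y, (y \in K) && (h y == i).
  have : i \in h @: K.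
    suff -> : h @: K = setT by rewrite inE.
    by apply/eqP; rewrite eqEcard subsetT cardsT card_ord card_in_imset ?cardK /=.
  by case/imsetP=> y yK ->; exists y; rewrite yK eqxx.
exists (fun i => xchoose (h_onto i)), h.
have eP i : xchoose (h_onto i) \in K /\ h (xchoose (h_onto i)) = i.
  by have /andP[? /eqP] := xchooseP (h_onto i).
split.
- by move=> i; case: (eP i).
- by move=> i; case: (eP i).
- by move=> y yK; have [eK eh] := eP (h y); apply: h_inj.
- move=> i; have [eK eh] := eP i; apply: val_inj.
  by rewrite hS ?(subsetP sK) // eK eh addn1.
move=> y yC yK; apply: val_inj.
by rewrite hS // (negPf yK) addn0 modn_small.
Qed.

Lemma full_cycleP k (tau : 'S_k) : 0 < k ->
  reflect (forall i j, j \in porbit tau i) (full_cycle tau).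
Proof.
move=> k_gt0; apply: (iffP eqP) => [full i j|full].
  have : porbit tau i \in porbits tau by exact: imset_f.
  by rewrite full => /set1P ->; rewrite inE.
apply/setP=> C; rewrite inE; apply/imsetP/eqP => [[i _ ->]|->].
  by apply/setP=> j; rewrite inE full.
exists (Ordinal k_gt0) => //; apply/setP=> j; rewrite inE.
by rewrite full.
Qed.

(** Such a [t] is a permutation [w] of [K], extended by the identity, followed by [s]. In the
    indices given by [e], the matching [tau] is [w] followed by [ordS]. *)
Lemma card_disagreement_full_cycle (T : finType) (s : {perm T}) (x : T)
    (K : {set T}) k :
    K \subset porbit s x -> #|K| = k -> 0 < k ->
  #|[set t | disagreement s t == K & porbit s x \in porbits t]| = f_count k.
Proof.
move=> sK cardK k_gt0.
have [e [h [eK eh he hse hs]]] := cyclic_indexing sK cardK k_gt0.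
(* [ord_pred] compensates for the [s] applied afterwards, which advances the index by one. *)
pose w (tau : 'S_k) y := if y \in K then e (ord_pred (tau (h y))) else y.
have w_inj tau : injective (w tau).
  move=> y z; rewrite /w; case: ifP => yK; case: ifP => zK //.
  - move/(can_inj eh)/ord_pred_inj/perm_inj => eq_h.
    by rewrite -(he y yK) eq_h he.
  - by move=> eyz; rewrite -eyz eK in zK.
  - by move=> eyz; rewrite eyz eK in yK.
(* psi inverts the contraction t |-> tau. *)
pose psi tau := (perm (w_inj tau) * s)%g.
have psiE tau y : psi tau y = s (w tau y) by rewrite permM permE.
have psi_e tau i : psi tau (e i) = s (e (ord_pred (tau i))).
  by rewrite psiE /w eK eh.
have psi_inj : injective psi.
  move=> tau tau' eq_psi; apply/permP=> i; apply: ord_pred_inj.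
  by apply: (can_inj eh); apply: (@perm_inj _ s); rewrite -!psi_e eq_psi.
have psiC tau y : y \in porbit s x -> psi tau y \in porbit s x.
  move=> yC; rewrite psiE mem_porbit_perm /w; case: ifP => // _.
  by rewrite (subsetP sK).
have h_psi tau y : y \in porbit s x ->
    h (psi tau y) = if y \in K then tau (h y) else h y.
  move=> yC; rewrite psiE /w; case: ifPn => yK; first by rewrite hse ord_predK.
  exact: hs.
(* Outside [K], [psi tau] follows [s] and keeps [h] constant, so from [y] it reaches [K] at
   [e (h y)]. The induction is on a number of [s]-steps that leads into [K]. *)
have next_K tau y : y \in porbit s x -> e (h y) \in porbit (psi tau) y.
  move=> yC; have [m mK] : exists m, (s ^+ m)%g y \in K.
    have eC : e (h y) \in porbit s y.
      by move: yC; rewrite -eq_porbit_mem => /eqP ->; rewrite (subsetP sK).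
    by case/porbitP: eC => m em; exists m; rewrite -em.
  elim: m => [|m IH] in y yC mK *.
    by rewrite expg0 perm1 in mK; rewrite he ?porbit_id.
  have [yK|yK] := boolP (y \in K); first by rewrite he ?porbit_id.
  have psiy : psi tau y = s y by rewrite psiE /w (negPf yK).
  rewrite -(hs y yC yK) -(porbit_perm (psi tau) 1 y) expg1 psiy.
  by apply: IH; rewrite ?mem_porbit_perm // -permM -expgS.
have psi_diff tau :
    (disagreement s (psi tau) == K) = [forall i, tau i != ordS i].
  apply/eqP/forallP => [defK i|neq].
    have := eK i; rewrite -defK inE psi_e (inj_eq perm_inj) (can_eq eh).
    by apply: contra => /eqP ->; rewrite ordSK.
  apply/setP=> y; rewrite inE psiE (inj_eq perm_inj) /w.
  case: ifPn => yK; last by rewrite eqxx.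
  rewrite -{2}(he y yK) (can_eq eh); apply: contra (neq (h y)) => /eqP eq_h.
  by rewrite -{2}eq_h ord_predK.
(* Forwards, [h] maps a [psi tau]-path inside the cycle to a path of [tau] with pauses. Backwards,
   [next_K] lifts each step of [tau] to a [psi tau]-path and joins every [y] of the cycle to
   [e (h y)]. *)
have psi_full tau : (porbit s x \in porbits (psi tau)) = full_cycle tau.
  apply/idP/(full_cycleP _ k_gt0) => [Ct i j|full].
    have eC l : e l \in porbit s x by rewrite (subsetP sK).
    have : e j \in porbit (psi tau) (e i) by rewrite -(porbit_mem_eq Ct).
    case/porbitP=> m defj; rewrite -[j]eh defj.
    suff [_ //] : (psi tau ^+ m)%g (e i) \in porbit s x /\
        h ((psi tau ^+ m)%g (e i)) \in porbit tau i.
    elim: m {defj} => [|m [mC mi]]; first by rewrite expg0 perm1 eh porbit_id.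
    rewrite expgSr permM psiC // h_psi //; split=> //.
    by case: ifP => // _; rewrite mem_porbit_perm.
  have tau_step i : porbit (psi tau) (e (tau i)) = porbit (psi tau) (e i).
    have eC : e i \in porbit s x by rewrite (subsetP sK).
    apply/eqP; rewrite eq_porbit_mem -(porbit_perm _ 1 (e i)) expg1.
    have -> : tau i = h (psi tau (e i)) by rewrite h_psi // eK eh.
    exact/next_K/psiC.
  have e_conn i j : porbit (psi tau) (e j) = porbit (psi tau) (e i).
    have /porbitP[m ->] := full i j; elim: m => [|m IH].
      by rewrite expg0 perm1.
    by rewrite expgSr permM tau_step.
  have h_conn y : y \in porbit s x ->
      porbit (psi tau) y = porbit (psi tau) (e (h y)).
    by move=> yC; apply/eqP; rewrite eq_sym eq_porbit_mem next_K.
  suff -> : porbit s x = porbit (psi tau) x by exact: imset_f.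
  apply/eqP; rewrite eqEsubset; apply/andP; split; apply/subsetP=> y.
    move=> yC; rewrite -eq_porbit_mem h_conn // (h_conn x) ?porbit_id //.
    exact/eqP/e_conn.
  case/porbitP=> m ->; elim: m => [|m IH]; first by rewrite expg0 perm1 porbit_id.
  by rewrite expgSr permM psiC.
rewrite /f_count -(card_imset _ psi_inj); apply: eq_card => t.
apply/idP/imsetP => [|[tau]]; last first.
  by rewrite !inE => /andP[full neq] ->; rewrite psi_diff psi_full neq full.
rewrite inE => /andP[/eqP defK Ct].
(* If [t y = s z] with [z] outside [K], then [t z = s z = t y], so [z = y], which lies in [K]. *)
have tK y : y \in K -> exists2 z, z \in K & t y = s z.
  move=> yK; exists ((s^-1)%g (t y)); last by rewrite permKV.
  apply: contraLR yK => zK; move: (zK).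
  rewrite -{1}defK inE permKV negbK => /eqP/perm_inj eq_z.
  by rewrite -eq_z.
have tau_inj : injective (fun i => h (t (e i))).
  move=> i j; have [y yK ty] := tK _ (eK i); have [z zK tz] := tK _ (eK j).
  rewrite ty tz -(he y yK) -(he z zK) !hse => /ordS_inj eq_h.
  by apply: (can_inj eh); apply: (@perm_inj _ t); rewrite ty tz -(he y yK) eq_h he.
have deft : t = psi (perm tau_inj).
  apply/permP=> y; rewrite psiE /w; case: ifPn => yK.
    rewrite permE he //; have [z zK ->] := tK y yK.
    by rewrite -{2}(he z zK) hse ordSK he.
  by apply/eqP; move: yK; rewrite -defK inE negbK.
exists (perm tau_inj) => //.
by rewrite inE -psi_full -psi_diff -deft Ct defK eqxx.
Qed.

(** * Counting the sets [K] and assembling the formula *)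

Lemma card_subset_porbits (T : finType) (s : {perm T}) k : 0 < k ->
  #|[set K : {set T} | #|K| == k & [exists C in porbits s, K \subset C]]| =
    \sum_(C in porbits s) 'C(#|C|, k).
Proof.
move=> k_gt0.
(* A nonempty [K] lies in at most one cycle, which [p] selects. The default [set0] is for sets that
   lie in none. *)
pose p (K : {set T}) := odflt set0 [pick C in porbits s | K \subset C].
rewrite -sum1dep_card (partition_big p (mem (porbits s))) /=; last first.
  move=> K /andP[_ /existsP[C CK]]; rewrite /p.
  by case: pickP => [D /andP[]//|/(_ C)]; rewrite CK.
apply: eq_bigr => C Cs; rewrite sum1dep_card -cards_draws.
apply: eq_card => K; rewrite !inE -andbA [RHS]andbC.
case: eqP => //= cardK; rewrite andbC.
have /card_gt0P[y yK] : 0 < #|K| by rewrite cardK.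
rewrite /p; case: pickP => [D /andP[Ds KD]|noC] /=; last first.
  have /existsPn/negPf -> : forall D, ~~ ((D \in porbits s) && (K \subset D)).
    by move=> D; rewrite noC.
  by move: (noC C); rewrite Cs andbF.
have -> : [exists D in porbits s, K \subset D].
  by apply/existsP; exists D; rewrite Ds.
rewrite andbT; apply/eqP/idP => [<- //|KC].
by rewrite (porbit_mem_eq Ds (subsetP KD y yK)) (porbit_mem_eq Cs (subsetP KC y yK)).
Qed.

(** Apply [alpha^-1] to both sides. With products composed left to right,
    [a |-> alpha^-1 (beta (alpha a))] is [beta ^ alpha^-1]. *)
Lemma bad_commuting_pointsE n (alpha beta : 'S_n) :
  bad_commuting_points alpha beta = disagreement beta (beta ^ alpha^-1)%g.
Proof.
apply/setP=> a; rewrite !inE /bad_commuting_point eq_sym.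
rewrite -[X in (beta ^ _)%g X](permK alpha) permJ.
by rewrite -[in RHS](inj_eq (@perm_inj _ alpha)) permKV.
Qed.

(** Cycles are grouped by length. Since [c] is prescribed only on 1, ..., n, the vanishing of [F]
    below a positive [k] disposes of length 0. *)
Lemma sum_porbits_cycle_type n (beta : 'S_n) c (F : nat -> nat) k :
    has_cycle_type beta c -> 0 < k ->
    (forall l, l < k -> F l = 0) ->
  \sum_(C in porbits beta) F #|C| = \sum_(k <= l < n.+1) c l * F l.
Proof.
move=> hc k_gt0 F0.
have leC (C : {set 'I_n}) : #|C| < n.+1.
  by rewrite ltnS -[X in _ <= X]card_ord max_card.
rewrite (partition_big (fun C : {set 'I_n} => Ordinal (leC C)) xpredT) //=.
rewrite big_geq_mkord [RHS]big_mkcond /=.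
apply: eq_bigr => l _; rewrite (eq_bigr (fun=> F l)) => [|C]; last first.
  by case/andP=> _ /eqP <-.
rewrite sum_nat_const; case: ifPn => [kl|]; last first.
  by rewrite -ltnNge => /F0 ->; rewrite muln0.
rewrite -hc; last by rewrite (leq_trans k_gt0 kl) -ltnS ltn_ord.
by congr (_ * _); apply: eq_card => C; rewrite !inE.
Qed.

Theorem theorem3 (n k : nat) (beta : 'S_n) (c : nat -> nat)
    (hc : has_cycle_type beta c) (hk : 3 <= k <= n) :
  c_lambda_single k beta =
    #|'C[beta]%g| * \sum_(k <= l < n.+1) c l * 'C(l, k) * f_count k.
Proof.
have k_gt0 : 0 < k by case/andP: hk => /ltnW/ltnW.
pose P (t : 'S_n) := (#|disagreement beta t| == k) &&
  [exists C in porbits beta, disagreement beta t \subset C].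
(* Substitute [g] for [alpha^-1]. *)
transitivity #|[set g | P (beta ^ g)%g]|.
  rewrite -(card_preimset _ invg_inj); apply: eq_card => alpha.
  by rewrite !inE /P /k_commutes bad_commuting_pointsE.
rewrite card_conjg_preim; congr (_ * _).
pose Ks := [set K : {set 'I_n} | #|K| == k &
  [exists C in porbits beta, K \subset C]].
transitivity (#|Ks| * f_count k); last first.
  rewrite card_subset_porbits // (sum_porbits_cycle_type (F := fun l => 'C(l, k)) hc k_gt0).
    by rewrite big_distrl.
  by move=> l /bin_small.
rewrite -sum1_card (partition_big (disagreement beta) (mem Ks)) /=; last first.
  by move=> t; rewrite !inE => /andP[].
rewrite -sum_nat_const; apply: eq_bigr => K.
rewrite inE => /andP[/eqP cardK exC]; case/existsP: (exC) => C /andP[Cs KC].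
case/imsetP: (Cs) => x _ defC.
rewrite defC in KC Cs.
rewrite sum1dep_card -(card_disagreement_full_cycle KC cardK k_gt0).
apply: eq_card => t; rewrite !inE andbC.
case: eqP => // defK; rewrite /P defK cardK eqxx exC !andbT /=.
by apply: porbits_conjgE; rewrite ?defK.
Qed.
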